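(* Let $S$ be a finite set of points in $\mathbb{R}^d$ and $z \in \mathbb{R}^d$. Suppose that $S$ is a $z$-containing set and $z$ is in general position with respect to $S$. Then $|\mathcal{A}(S)| \le (d+1)\,|\mathcal{C}(S)|$.
   Context: For $X \subseteq S$, $\mathrm{conv}(X)$ is the convex hull of $X$ and $R(X)$ is the smallest affine subspace containing $X$. A set $X \subseteq S$ is $z$-containing if $z$ lies in the interior of $\mathrm{conv}(X)$, and $z$-avoiding otherwise. $\mathcal{C}(S)$ is the set of minimal (under inclusion) $z$-containing subsets of $S$, and $\mathcal{A}(S)$ is the set of maximal (under inclusion, among subsets of $S$) $z$-avoiding subsets of $S$. The point $z$ is in general position with respect to $S$ if for every $X \subseteq S$ with $\dim R(X) < d$ we have $z \notin R(X)$. *)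

(* Defs.v *)
From HB Require Import structures.
From mathcomp Require Import all_boot all_order all_algebra finmap.
From mathcomp Require Import boolp classical_sets reals topology normedtype convex.

Set Implicit Arguments.
Unset Strict Implicit.
Unset Printing Implicit Defensive.

Import GRing.Theory numFieldNormedType.Exports.

Local Open Scope classical_set_scope.
Local Open Scope ring_scope.

Section Definitions.
Variables (R : realType) (d : nat).
Implicit Types (A : set 'rV[R]_d) (X S : {fset 'rV[R]_d}) (z : 'rV[R]_d).

Definition conv A : set 'rV[R]_d := smallest (@convex_set R 'rV[R]_d) A.

(* The empty set is an affine subspace but has no dimension in this sense. *)
Definition has_affine_dim A (k : nat) : Prop :=
  exists (p : 'rV[R]_d) (U : {vspace 'rV[R]_d}),
    A = [set p + u | u in [set` U]] /\ \dim U = k.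

Definition affine_subspace A : Prop :=
  A = set0 \/ exists k : nat, has_affine_dim A k.

Definition affine_hull A : set 'rV[R]_d := smallest affine_subspace A.

Definition z_containing z X : Prop := interior (conv [set` X]) z.

Definition z_avoiding z X : Prop := ~ z_containing z X.

Definition min_containing z S : {fset {fset 'rV[R]_d}} :=
  [fset X in fpowerset S | `[< z_containing z X /\
     forall Y, (Y `<=` X)%fset -> z_containing z Y -> Y = X >]]%fset.

Definition max_avoiding z S : {fset {fset 'rV[R]_d}} :=
  [fset X in fpowerset S | `[< z_avoiding z X /\
     forall Y, (Y `<=` S)%fset -> (X `<=` Y)%fset -> z_avoiding z Y -> Y = X >]]%fset.

(* The empty X has an empty affine hull, so excluding it (it has no dimension)
   loses nothing. *)
Definition general_position z S : Prop :=
  forall X, (X `<=` S)%fset ->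
  forall k : nat, has_affine_dim (affine_hull [set` X]) k -> (k < d)%N ->
  ~ affine_hull [set` X] z.

End Definitions.

(* Main.v *)
Require Import Defs.
From mathcomp Require Import all_boot all_order all_algebra finmap.
From mathcomp Require Import boolp classical_sets reals topology normedtype convex.
From mathcomp Require Import interval_inference ring lra.

(* Under general position, X is z-containing as soon as z lies in conv X, and no
   nonzero functional is nonnegative on X - z. Hence a maximal avoiding set A is
   {s in S | w (s - z) >= 0} for every nonzero w that is nonnegative on A - z.
   Fix an enumeration of S, let y be the first point of A and x a point of S
   outside A. The ray from y - z through z - x leaves the cone of A - z through
   a facet, with inner normal w say. Then z is in the convex hull of x, y and
   the points of that facet, and a minimal containing subset C of those contains
   x and y. Conversely the pair (C, x) determines A: y is the first point of
   C \ x, and w is, up to a positive factor, the only functional vanishing on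
   C \ {x, y} and positive at y. So A |-> (C, x) is injective, and |C| <= d + 1
   by Caratheodory's theorem. *)

Set Implicit Arguments.
Unset Strict Implicit.
Unset Printing Implicit Defensive.

Import Order.TTheory GRing.Theory Num.Theory numFieldNormedType.Exports.

(** * Linear dependence and theorems of the alternative *)

Section Farkas.
Local Open Scope ring_scope.

Lemma linear_dependence (F : fieldType) n (I : eqType) (s : seq I)
    (f : I -> 'rV[F]_n) : uniq s -> (n < size s)%N ->
  exists2 m : I -> F, \sum_(i <- s) m i *: f i = 0
    & exists2 i, i \in s & m i != 0.
Proof.
case: s => [//|i0 s0]; set s := i0 :: s0 => us ns.
pose M : 'M[F]_(size s, n) := \matrix_(i < size s) f (nth i0 s i).
have /rowV0Pn[k /sub_kermxP kM k0] : kermx M != 0.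
  rewrite kermx_eq0 /row_free neq_ltn (leq_ltn_trans (rank_leq_col M))//.
pose m i := k 0 (inord (index i s)).
have mE (j : 'I_(size s)) : m (nth i0 s j) = k 0 j.
  by rewrite /m index_uniq// inord_val.
exists m.
  rewrite (big_nth i0) big_mkord -[RHS]kM mulmx_sum_row.
  by apply: eq_bigr => j _; rewrite mE rowK.
have [j kj] := rV0Pn _ k0.
by exists (nth i0 s j); rewrite ?mem_nth ?mE.
Qed.

Variable R : realFieldType.

Definition dot n (w v : 'rV[R]_n) : R := (w *m v^T) 0 0.

Lemma dotE n (w v : 'rV[R]_n) : dot w v = \sum_i w 0 i * v 0 i.
Proof. by rewrite /dot mxE; apply: eq_bigr => i _; rewrite mxE. Qed.

Lemma dotDl n (w w' v : 'rV[R]_n) : dot (w + w') v = dot w v + dot w' v.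
Proof. by rewrite /dot mulmxDl mxE. Qed.

Lemma dotZl n a (w v : 'rV[R]_n) : dot (a *: w) v = a * dot w v.
Proof. by rewrite /dot -scalemxAl mxE. Qed.

Lemma dotC n (w v : 'rV[R]_n) : dot w v = dot v w.
Proof. by rewrite !dotE; apply: eq_bigr => i _; rewrite mulrC. Qed.

Lemma dotDr n (w v v' : 'rV[R]_n) : dot w (v + v') = dot w v + dot w v'.
Proof. by rewrite !(dotC w) dotDl. Qed.

Lemma dotZr n a (w v : 'rV[R]_n) : dot w (a *: v) = a * dot w v.
Proof. by rewrite !(dotC w) dotZl. Qed.

Lemma dotNl n (w v : 'rV[R]_n) : dot (- w) v = - dot w v.
Proof. by rewrite -scaleN1r dotZl mulN1r. Qed.

Lemma dotNr n (w v : 'rV[R]_n) : dot w (- v) = - dot w v.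
Proof. by rewrite !(dotC w) dotNl. Qed.

Lemma dot_sumr n (I : Type) (r : seq I) (w : 'rV[R]_n) (f : I -> 'rV[R]_n) :
  dot w (\sum_(i <- r) f i) = \sum_(i <- r) dot w (f i).
Proof.
apply: (big_morph (dot w)) => [u v|]; first exact: dotDr.
by rewrite /dot trmx0 mulmx0 mxE.
Qed.

Lemma dot_comb n (I : Type) (r : seq I) (w : 'rV[R]_n) (l : I -> R)
    (f : I -> 'rV[R]_n) :
  dot w (\sum_(i <- r) l i *: f i) = \sum_(i <- r) l i * dot w (f i).
Proof. by rewrite dot_sumr; apply: eq_bigr => i _; rewrite dotZr. Qed.

Lemma dot_eq0 n (w : 'rV[R]_n) : dot w w = 0 -> w = 0.
Proof.
rewrite dotE => /eqP; rewrite psumr_eq0 => [/allP w0|i _]; last first.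
  by rewrite -expr2 sqr_ge0.
apply/rowP => i; apply/eqP; rewrite mxE -sqrf_eq0 expr2.
by apply: w0; rewrite mem_index_enum.
Qed.

(* Induction on the number of vectors: a functional w separating b from the
   cone of the tail but negative on the head a is repaired by projecting
   everything along a onto the kernel of w. *)
Lemma farkas n (I : eqType) (s : seq I) (f : I -> 'rV[R]_n) (b : 'rV[R]_n) :
  uniq s ->
  (exists2 l : I -> R, (forall i, 0 <= l i) & b = \sum_(i <- s) l i *: f i)
  \/ (exists2 w, (forall i, i \in s -> 0 <= dot w (f i)) & dot w b < 0).
Proof.
elim: s f b => [|i0 s IH] f b /=.
  move=> _; have [->|b0] := eqVneq b 0.
    by left; exists (fun=> 0) => //; rewrite big_nil.
  right; exists (- b) => //; rewrite dotNl oppr_lt0 lt0r.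
  rewrite (contra_neq (@dot_eq0 _ b) b0) dotE sumr_ge0// => i _.
  by rewrite -expr2 sqr_ge0.
case/andP=> i0s us.
have extend (l : I -> R) c (g : I -> 'rV[R]_n) :
    c *: g i0 + \sum_(i <- s) l i *: g i =
    \sum_(i <- i0 :: s) (if i == i0 then c else l i) *: g i.
  rewrite big_cons eqxx; congr (_ + _); apply: eq_big_seq => i si.
  by case: eqP => // ii0; rewrite -ii0 si in i0s.
case: (IH f b us) => [[l l0 bE]|[w w0 wb]].
  left; exists (fun i => if i == i0 then 0 else l i).
    by move=> i; case: ifP.
  by rewrite -extend scale0r add0r.
have [wi0|wi0] := leP 0 (dot w (f i0)).
  by right; exists w => // i; rewrite inE => /orP[/eqP->|/w0].
pose q v := dot w v / dot w (f i0).
pose f' i := f i - q (f i) *: f i0.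
case: (IH f' (b - q b *: f i0) us) => [[l l0 bE]|[w' w'0 w'b]].
  (* [c] collects all multiples of the head. It is nonnegative: [q b] is a quotient of two negative
     numbers, and every [q (f i)] is at most 0. *)
  left; pose c := q b - \sum_(i <- s) l i * q (f i).
  exists (fun i => if i == i0 then c else l i) => [i|].
    case: ifP => // _; rewrite /c subr_ge0.
    apply: (@le_trans _ _ 0).
      rewrite big_seq sumr_le0// => j js; rewrite mulr_ge0_le0//.
      by rewrite mulr_ge0_le0 ?w0// invr_le0 ltW.
    by rewrite mulr_le0// ?invr_le0 ltW.
  rewrite -extend; move/eqP: bE; rewrite subr_eq => /eqP ->.
  rewrite /c scalerBl scaler_suml addrC -addrA; congr (_ + _).
  rewrite addrC -sumrB; apply: eq_bigr => i _.
  by rewrite /f' scalerBr scalerA.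
pose w'' := w' - (dot w' (f i0) / dot w (f i0)) *: w.
have w''E v : dot w'' v = dot w' (v - q v *: f i0).
  by rewrite dotDl dotNl dotZl dotDr dotNr dotZr /q; ring.
right; exists w'' => [i|]; last by rewrite w''E.
rewrite inE => /orP[/eqP->|si]; rewrite w''E; last exact: w'0.
by rewrite /q divff ?lt_eqF// scale1r subrr dotC /dot mul0mx mxE.
Qed.

(** Farkas for the lifted vectors (1, f i) and the target (1, 0): the extra coordinate makes the
    weights sum to 1. A separating functional (a, w) has a < 0 by its value at the target, so a + w
    f_i >= 0 gives strict positivity. *)
Lemma gordan n (I : eqType) (s : seq I) (f : I -> 'rV[R]_n) :
  uniq s ->
  (exists l : I -> R, [/\ forall i, 0 <= l i, \sum_(i <- s) l i = 1
     & \sum_(i <- s) l i *: f i = 0])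
  \/ (exists w, forall i, i \in s -> 0 < dot w (f i)).
Proof.
move=> us.
pose g i : 'rV[R]_(1 + n) := row_mx 1 (f i).
have dotg (w : 'rV[R]_(1 + n)) a v :
    dot w (row_mx a%:M v) = lsubmx w 0 0 * a + dot (rsubmx w) v.
  rewrite !dotE big_split_ord /= big_ord1 row_mxEl !mxE eqxx; congr (_ + _).
  by apply: eq_bigr => i _; rewrite row_mxEr !mxE.
case: (farkas g (row_mx 1 0) us) => [[l l0 E]|[w w0 wb]].
  left; exists l; have F k : row_mx 1 0 0 k = \sum_(i <- s) l i * g i 0 k.
    by rewrite E summxE; apply: eq_bigr => i _; rewrite !mxE.
  split => //.
    have := F (lshift n ord0); rewrite row_mxEl mxE eqxx mulr1n => ->.
    by apply: eq_bigr => i _; rewrite row_mxEl mxE eqxx mulr1n mulr1.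
  apply/rowP => k; have := F (rshift 1 k); rewrite row_mxEr => ->.
  by rewrite summxE; apply: eq_bigr => i _; rewrite row_mxEr mxE.
right; exists (rsubmx w) => i /w0; move: wb; rewrite /g !dotg !mulr1.
have -> : dot (rsubmx w) 0 = 0 by rewrite /dot trmx0 mulmx0 mxE.
rewrite addr0; lra.
Qed.

End Farkas.

(** * Convex and affine hulls, interiors and general position *)

Section Hulls.
Local Open Scope classical_set_scope.
Local Open Scope ring_scope.
Variables (R : realType) (d : nat).
Implicit Types (X S : {fset 'rV[R]_d}) (z w : 'rV[R]_d).

Lemma convex_set_comb (D : set 'rV[R]_d) (r : seq 'rV[R]_d)
    (l : 'rV[R]_d -> R) :
  @convex_set R 'rV[R]_d D -> (forall s, s \in r -> D s) ->
  (forall s, 0 <= l s) -> \sum_(s <- r) l s = 1 -> D (\sum_(s <- r) l s *: s).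
Proof.
move=> cD; elim: r l => [l _ _|s r IH l Dr l0].
  by rewrite big_nil => /eqP; rewrite eq_sym oner_eq0.
rewrite !big_cons => l1.
have Ds : D s by apply: Dr; rewrite mem_head.
have Dtail t : t \in r -> D t by move=> tr; apply: Dr; rewrite inE tr orbT.
have t0 : 0 <= \sum_(j <- r) l j by rewrite sumr_ge0.
have [tE|tN0] := eqVneq (\sum_(j <- r) l j) 0.
  rewrite tE addr0 in l1; rewrite l1 scale1r big_seq big1 ?addr0// => j jr.
  move/eqP: tE; rewrite psumr_eq0// => /allP/(_ _ jr)/=/eqP->.
  by rewrite scale0r.
set t := \sum_(j <- r) l j in l1 t0 tN0.
have ls1 : l s <= 1 by lra.
have tE : 1 - l s = t by lra.
have Dm : D (\sum_(j <- r) (l j / t) *: j).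
  apply: (IH (fun j => l j / t)) => // [j|]; first by rewrite divr_ge0.
  by rewrite -mulr_suml divff.
have := cD s (\sum_(j <- r) (l j / t) *: j) (Itv01 (l0 s) ls1).
rewrite !inE => /(_ Ds Dm); congr D.
have -> : \sum_(j <- r) l j *: j = (1 - l s) *: \sum_(j <- r) (l j / t) *: j.
  rewrite tE scaler_sumr; apply: eq_bigr => j _.
  by rewrite scalerA mulrC divfK.
by [].
Qed.

(** The explicit combinations form a convex set containing [X]. They are centred at [z] so that
    functionals apply directly to the vectors [s - z]. *)
Lemma convP X z : Defs.conv [set` X] z <->
  exists l : 'rV[R]_d -> R, [/\ forall s, 0 <= l s, \sum_(s <- X) l s = 1
    & \sum_(s <- X) l s *: (s - z) = 0].
Proof.
have shift (l : 'rV[R]_d -> R) y : \sum_(s <- X) l s = 1 ->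
    \sum_(s <- X) l s *: (s - y) = \sum_(s <- X) l s *: s - y.
  move=> l1; under eq_bigr do rewrite scalerBr.
  by rewrite sumrB -scaler_suml l1 scale1r.
split=> [|[l [l0 l1 lz]]]; last first.
  move/eqP: lz; rewrite shift// subr_eq0 => /eqP <- D [cD XD].
  by apply: convex_set_comb.
suff: Defs.conv [set` X] `<=` [set y | exists l : 'rV[R]_d -> R,
    [/\ forall s, 0 <= l s, \sum_(s <- X) l s = 1
      & \sum_(s <- X) l s *: s = y]].
  move=> /(_ z) h /h [l [l0 l1 lz]]; exists l; split => //.
  by rewrite shift// lz subrr.
apply: smallest_sub => [x y t|s /= sX].
  rewrite !inE => -[l [l0 l1 <-]] [m [m0 m1 <-]].
  exists (fun s => t%:num * l s + (1 - t%:num) * m s); split.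
  - by move=> s; rewrite addr_ge0// mulr_ge0// subr_ge0.
  - by rewrite big_split/= -!mulr_sumr l1 m1 !mulr1 addrC subrK.
  - under eq_bigr do rewrite scalerDl -!scalerA.
    by rewrite big_split/= -!scaler_sumr.
exists (fun t => (t == s)%:R); split => [t||]; first by case: eqP.
- rewrite (big_fsetD1 s)//= eqxx big_seq big1 ?addr0// => t.
  by rewrite in_fsetD1 => /andP[/negPf->].
- rewrite (big_fsetD1 s)//= eqxx scale1r big_seq big1 ?addr0// => t.
  by rewrite in_fsetD1 => /andP[/negPf-> _]; rewrite scale0r.
Qed.

Lemma conv_or_open_halfspace X z : Defs.conv [set` X] z \/
  exists w, forall s, s \in X -> 0 < dot w (s - z).
Proof.
case: (gordan (fun s => s - z) (fset_uniq X)) => [|[w ?]]; last by right; exists w.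
by move/convP; left.
Qed.

Lemma conv_open_halfspaceF X z w :
  Defs.conv [set` X] z -> (forall s, s \in X -> 0 < dot w (s - z)) -> False.
Proof.
move=> /convP[l [l0 l1 lz]] w0.
have : \sum_(s <- X) l s * dot w (s - z) = 0.
  by rewrite -dot_comb lz /dot trmx0 mulmx0 mxE.
move/eqP; rewrite big_seq psumr_eq0 => [/allP h|s sX]; last first.
  by rewrite mulr_ge0// ltW ?w0.
move/eqP: l1; rewrite big_seq big1 ?(eq_sym 0) ?oner_eq0// => s sX.
by have := h _ sX; rewrite sX mulf_eq0 (gt_eqF (w0 _ sX)) orbF => /eqP.
Qed.

(** An affine subspace p + V containing [X] has all differences s - s0 in V, hence contains the
    right-hand side. *)
Lemma affine_hull_span X (s0 : 'rV[R]_d) : s0 \in X ->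
  affine_hull [set` X] =
  [set s0 + u | u in [set` <<[seq s - s0 | s <- X]>>%VS]].
Proof.
move=> s0X; apply/seteqP; split.
  apply: smallest_sub; first by right; exists (\dim <<[seq s - s0 | s <- X]>>), s0,
    <<[seq s - s0 | s <- X]>>%VS.
  move=> s /= sX; exists (s - s0); last by rewrite addrC subrK.
  by rewrite /=; apply: memv_span; apply: map_f.
move=> _ [u uU <-] D [[->|[k [p [V [-> _]]]]] XD]; first by have := XD _ s0X.
have XV s : s \in X -> s - p \in V.
  by move=> /XD [v vV <-]; rewrite addrC addrA addNr add0r.
exists (s0 - p + u); last by rewrite addrA [p + _]addrC subrK.
apply: memvD; first exact: XV.
move: uU; apply/subvP/span_subvP => _ /mapP[s sX ->].
have -> : s - s0 = (s - p) - (s0 - p) by rewrite opprB addrA subrK.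
by rewrite memvB ?XV.
Qed.

(** If the span were the whole space, [w] would lie in it and be orthogonal to itself. *)
Lemma dim_span_orthogonal (r : seq 'rV[R]_d) w :
  w != 0 -> (forall v, v \in r -> dot w v = 0) -> (\dim <<r>> < d)%N.
Proof.
move=> w0 wr; have := dimvS (subvf <<r>>%VS).
rewrite dimvf dim_matrix mul1r leq_eqVlt => /orP[|//] /eqP dimE.
have wU : w \in <<r>>%VS.
  suff -> : <<r>>%VS = fullv by rewrite memvf.
  by apply/eqP; rewrite eqEdim subvf dimvf dim_matrix mul1r dimE/=.
case/negP: w0; apply/eqP/dot_eq0.
rewrite [X in dot _ X](@coord_span _ _ _ (in_tuple r) w)//.
rewrite dot_sumr big1// => i _; rewrite dotZr wr ?mulr0//.
by rewrite mem_nth.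
Qed.

(** For nonzero [w], the points of positive weight in a combination equal to [z] would lie on a
    hyperplane through [z]. Their affine hull would contain [z] and have dimension below [d]. *)
Lemma general_position_supporting z S X w : general_position z S ->
  (X `<=` S)%fset -> Defs.conv [set` X] z ->
  (forall s, s \in X -> 0 <= dot w (s - z)) -> w = 0.
Proof.
move=> gp XS /convP[l [l0 l1 lz]] wX; apply/eqP/negPn/negP => w0.
pose X0 := [fset s in X | l s != 0]%fset.
have wX0 s : s \in X0 -> dot w (s - z) = 0.
  rewrite !inE/= => /andP[sX ls].
  have : \sum_(s <- X) l s * dot w (s - z) = 0.
    by rewrite -dot_comb lz /dot trmx0 mulmx0 mxE.
  move/eqP; rewrite big_seq psumr_eq0 => [|t tX]; last by rewrite mulr_ge0// wX.
  by move=> /allP/(_ _ sX); rewrite sX mulf_eq0 (negPf ls) => /eqP.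
have [s0 s0X0] : exists s, s \in X0.
  apply: contrapT => no; move/eqP: l1; rewrite big_seq big1 ?(eq_sym 0) ?oner_eq0//.
  move=> s sX; apply/eqP/negPn/negP => ls; apply: no; exists s.
  by rewrite !inE/= sX.
have X0S : (X0 `<=` S)%fset.
  by apply: fsubset_trans XS; apply/fsubsetP => s; rewrite !inE => /andP[].
set U := <<[seq s - s0 | s <- X0]>>%VS.
have hullE := affine_hull_span s0X0.
apply: (gp X0 X0S (\dim U)).
- by exists s0, U.
- apply: (@dim_span_orthogonal _ w) => // _ /mapP[s sX0 ->].
  have -> : s - s0 = (s - z) - (s0 - z) by rewrite opprB addrA subrK.
  by rewrite dotDr dotNr !wX0// subrr.
rewrite hullE; exists (z - s0); last by rewrite addrC subrK.
have -> : z - s0 = \sum_(s <- X) l s *: (s - s0).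
  apply/eqP; rewrite -subr_eq0 -oppr_eq0 opprB -[X in _ - X]scale1r -l1.
  rewrite scaler_suml -sumrB -[X in _ == X]lz; apply/eqP/eq_bigr => s _.
  by rewrite -scalerBr opprB addrA subrK.
rewrite big_seq; apply: memv_suml => s sX.
have [->|ls] := eqVneq (l s) 0; first by rewrite scale0r mem0v.
by apply/memvZ/memv_span/map_f; rewrite !inE/= sX.
Qed.

(** By Farkas the vectors [s - z] generate the whole space as a cone. A short displacement from [z]
    is then a combination of total weight at most 1, and the missing weight goes to a representation
    of [z]. *)
Lemma conv_interior X z : Defs.conv [set` X] z ->
  (forall w, (forall s, s \in X -> 0 <= dot w (s - z)) -> w = 0) ->
  z_containing z X.
Proof.
move=> /convP[l [l0 l1 lz]] nosupp.
have cone b : exists l : 'rV[R]_d -> R, (forall s, 0 <= l s) /\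
    b = \sum_(s <- X) l s *: (s - z).
  case: (farkas (fun s => s - z) b (fset_uniq X)) => [[m m0 bE]|[w /nosupp->]].
    by exists m.
  by rewrite /dot mul0mx mxE ltxx.
have {cone}[c cP] := choice cone.
pose e i : 'rV[R]_d := delta_mx 0 i.
(* The total weight used to represent all unit vectors and their opposites; since it may be 0, the
   radius below is 1 / (M + 1). *)
pose M := \sum_(s <- X) \sum_i (c (e i) s + c (- e i) s).
have M0 : 0 <= M.
  by do 2 (apply: sumr_ge0 => ? _); rewrite addr_ge0//; apply: (cP _).1.
rewrite /z_containing /interior/=; apply/nbhs_ballP.
exists (M + 1)^-1; first by rewrite /= invr_gt0; lra.
move=> y yB; apply/convP.
pose u := y - z.
have uB i : `|u 0 i| <= (M + 1)^-1.
  by have := yB.2 0 i; rewrite /ball/= distrC !mxE => /ltW.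
pose g i := if 0 <= u 0 i then e i else - e i.
have gE i : u 0 i *: e i = `|u 0 i| *: g i.
  rewrite /g; have [h|h] := leP 0 (u 0 i); first by rewrite ger0_norm.
  by rewrite ltr0_norm// scalerN scaleNr opprK.
pose m s := \sum_i `|u 0 i| * c (g i) s.
have m0 s : 0 <= m s.
  by apply: sumr_ge0 => i _; rewrite mulr_ge0//; apply: (cP _).1.
have mu : \sum_(s <- X) m s *: (s - z) = u.
  under eq_bigr do rewrite scaler_suml.
  rewrite exchange_big/= [RHS]row_sum_delta; apply: eq_bigr => i _.
  rewrite gE [in RHS](cP (g i)).2 scaler_sumr.
  by apply: eq_bigr => s _; rewrite scalerA.
have m1 : \sum_(s <- X) m s <= 1.
  apply: (@le_trans _ _ ((M + 1)^-1 * M)); last by rewrite mulrC ler_pdivrMr; lra.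
  rewrite mulr_sumr; apply: ler_sum => s _; rewrite mulr_sumr; apply: ler_sum => i _.
  apply: ler_pM => //; first exact: (cP _).1.
  by rewrite /g; case: ifP => _; rewrite ?lerDl ?lerDr; apply: (cP _).1.
set t := \sum_(s <- X) m s in m1.
exists (fun s => (1 - t) * l s + m s); split.
- by move=> s; rewrite addr_ge0// mulr_ge0// subr_ge0.
- by rewrite big_split/= -mulr_sumr l1 mulr1 subrK.
have sE s : s - y = (s - z) - u by rewrite /u opprB addrA subrK.
under eq_bigr do rewrite sE scalerBr scalerDl -scalerA.
rewrite sumrB big_split/= -scaler_sumr lz scaler0 add0r mu -scaler_suml.
by rewrite big_split/= -mulr_sumr l1 mulr1 subrK scale1r subrr.
Qed.

End Hulls.

(** * Minimal containing and maximal avoiding sets in general position *)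

Section Avoiding.
Local Open Scope classical_set_scope.
Local Open Scope ring_scope.

Variables (R : realType) (d : nat) (z : 'rV[R]_d) (S : {fset 'rV[R]_d}).
Hypothesis gp : general_position z S.
Implicit Types (A C X : {fset 'rV[R]_d}) (w x y : 'rV[R]_d).

Lemma containingE X : (X `<=` S)%fset ->
  z_containing z X <-> Defs.conv [set` X] z.
Proof.
move=> XS; split => [/interior_subset//|Xz].
by apply: conv_interior => // w; apply: general_position_supporting gp XS Xz.
Qed.

Lemma avoiding_halfspace X : (X `<=` S)%fset -> z_avoiding z X ->
  exists w, forall s, s \in X -> 0 < dot w (s - z).
Proof.
move=> XS nX; case: (conv_or_open_halfspace X z) => // Xz.
by case: nX; apply/containingE.
Qed.

Lemma min_containingP C : reflect
  [/\ (C `<=` S)%fset, z_containing z C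
    & forall X, (X `<=` C)%fset -> z_containing z X -> X = C]
  (C \in min_containing z S).
Proof.
rewrite !inE/= fpowersetE; apply: (iffP andP) => [[CS /asboolP[]]//|[CS Cz Cm]].
by split => //; apply/asboolP.
Qed.

Lemma max_avoidingP A : reflect
  [/\ (A `<=` S)%fset, z_avoiding z A
    & forall X, (X `<=` S)%fset -> (A `<=` X)%fset -> z_avoiding z X -> X = A]
  (A \in max_avoiding z S).
Proof.
rewrite !inE/= fpowersetE; apply: (iffP andP) => [[AS /asboolP[]]//|[AS Az Am]].
by split => //; apply/asboolP.
Qed.

Lemma min_containing_sub X : (X `<=` S)%fset -> z_containing z X ->
  exists2 C, (C `<=` X)%fset & C \in min_containing z S.
Proof.
have [n] := ubnP #|` X|; elim: n X => // n IH X Xn XS Xz.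
have [Xm|/existsNP[Y /not_implyP[YX /not_implyP[Yz YneX]]]] :=
  pselect (forall Y, (Y `<=` X)%fset -> z_containing z Y -> Y = X).
  by exists X => //; apply/min_containingP.
have YltX : (Y `<` X)%fset by rewrite fproperEneq YX andbT; apply/eqP.
have [|||C CY Cm] := IH Y => //.
- by apply: leq_trans (fproper_ltn_card YltX) _.
- exact: fsubset_trans YX XS.
- by exists C => //; apply: fsubset_trans CY YX.
Qed.

(* If [C] had more points, one step of Caratheodory's reduction would drop a
   point of [C] and keep [z] in the hull, hence, by general position, in its
   interior. *)
Lemma min_containing_card C : C \in min_containing z S -> (#|` C| <= d.+1)%N.
Proof.
case/min_containingP => CS Cz Cm; rewrite leqNgt; apply/negP => dC.
have /convP[l [l0 l1 lz]] := (containingE CS).1 Cz.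
(* The coordinate 1 makes the linear dependence an affine one: the coefficients [m] also sum to
   0. *)
pose g s : 'rV[R]_(1 + d) := row_mx 1 (s - z).
have [m mg [s1 s1C ms1]] := linear_dependence g (fset_uniq C) dC.
have mgk k : \sum_(s <- C) m s * g s 0 k = 0.
  have /rowP/(_ k) := mg; rewrite summxE mxE => mgk; rewrite -[RHS]mgk.
  by apply: eq_bigr => s _; rewrite [RHS]mxE.
have m0 : \sum_(s <- C) m s = 0.
  rewrite -[RHS](mgk (lshift d ord0)); apply: eq_bigr => s _.
  by rewrite row_mxEl mxE eqxx mulr1n mulr1.
have mz : \sum_(s <- C) m s *: (s - z) = 0.
  apply/rowP => k; rewrite summxE [RHS]mxE -[RHS](mgk (rshift 1 k)).
  by apply: eq_bigr => s _; rewrite row_mxEr mxE.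
have [s2 s2C ms2] : exists2 s, s \in C & 0 < m s.
  apply: contrapT => no; move/eqP: m0; rewrite -oppr_eq0 -sumrN big_seq.
  have npos s : s \in C -> 0 <= - m s.
    by move=> sC; rewrite oppr_ge0 leNgt; apply/negP => ms; apply: no; exists s.
  rewrite psumr_eq0// => /allP/(_ _ s1C); rewrite s1C oppr_eq0.
  by rewrite (negPf ms1).
(* The least ratio l / m over the points with m > 0 is the largest t that keeps l - t m nonnegative
   on [C], and it kills the weight of [s3]. *)
have [s3 ms3 s3min] := @arg_minP _ R C [` s2C]%fset
  (fun s => 0 < m (val s)) (fun s => l (val s) / m (val s)) ms2.
pose t := l (val s3) / m (val s3).
have t0 : 0 <= t by rewrite divr_ge0// ltW.
pose l' s := l s - t * m s.
have l's3 : l' (val s3) = 0 by rewrite /l' /t divfK ?subrr ?gt_eqF.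
have l'0 s : s \in C -> 0 <= l' s.
  move=> sC; rewrite subr_ge0; have [ms|ms] := leP (m s) 0.
    by apply: le_trans (l0 s); rewrite mulr_ge0_le0.
  by rewrite -ler_pdivlMr//; apply: (s3min [` sC]%fset).
have l'1 : \sum_(s <- C) l' s = 1.
  by rewrite sumrB -mulr_sumr m0 mulr0 subr0.
have l'z : \sum_(s <- C) l' s *: (s - z) = 0.
  under eq_bigr do rewrite scalerBl -scalerA.
  by rewrite sumrB -scaler_sumr mz scaler0 subr0.
have DC := fsubD1set C (val s3).
(* By minimality [C] without [s3] is avoiding; a functional positive on it forces all weights [l']
   to vanish, although they sum to 1. *)
have [|u u0] := avoiding_halfspace (fsubset_trans DC CS).
  by move=> /(Cm _ DC) /fsetP/(_ (val s3)); rewrite !inE eqxx (valP s3).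
have : \sum_(s <- C) l' s * dot u (s - z) = 0.
  by rewrite -dot_comb l'z /dot trmx0 mulmx0 mxE.
have uC s : s \in C -> s != val s3 -> 0 < dot u (s - z).
  by move=> sC ss3; apply: u0; rewrite !inE ss3.
move/eqP; rewrite big_seq psumr_eq0 => [/allP h|s sC]; last first.
  have [->|ss3] := eqVneq s (val s3); first by rewrite l's3 mul0r.
  by rewrite mulr_ge0 ?l'0// ltW ?uC.
move/eqP: l'1; rewrite big_seq big1 ?(eq_sym 0) ?oner_eq0// => s sC.
have [->//|ss3] := eqVneq s (val s3).
by have := h _ sC; rewrite sC mulf_eq0 (gt_eqF (uC _ sC ss3)) orbF => /eqP.
Qed.

(** Adding to [A] a point where [w] is nonnegative keeps the set avoiding, by general position;
    maximality then puts the point in [A]. *)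
Lemma max_avoiding_halfspace A w s : A \in max_avoiding z S -> w != 0 ->
  (forall t, t \in A -> 0 <= dot w (t - z)) -> s \in S ->
  (s \in A) = (0 <= dot w (s - z)).
Proof.
case/max_avoidingP => AS Az Am w0 wA sS; apply/idP/idP => [/wA//|ws].
have sAS : (s |` A `<=` S)%fset by rewrite fsubUset fsub1set sS.
suff <- : (s |` A)%fset = A by rewrite fset1U1.
apply: Am => //; first exact: fsubsetUr.
move=> /(containingE sAS) sAz; case/negP: w0; apply/eqP.
apply: (general_position_supporting gp sAS sAz) => t.
by rewrite in_fset1U => /orP[/eqP->|/wA].
Qed.

(* [w] is an inner normal of a facet of the cone of [A - z] containing the last
   point, in that cone, of the ray from [y - z] through [z - x]; this point is
   [p] below, up to scaling. *)
Lemma pulling_facet A x y : A \in max_avoiding z S ->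
  y \in A -> x \in S -> x \notin A ->
  exists w C, [/\ forall s, s \in A -> 0 <= dot w (s - z),
    0 < dot w (y - z),
    C \in min_containing z S,
    [/\ x \in C, y \in C & (C `<=` x |` A)%fset]
    & forall s, s \in C -> s != x -> s != y -> dot w (s - z) = 0].
Proof.
move=> Amax yA xS xA; case/max_avoidingP: (Amax) => AS Az Am.
have dot0 w : dot w (0 : 'rV[R]_d) = 0 by rewrite /dot trmx0 mulmx0 mxE.
have neg_x w : (forall s, s \in A -> 0 <= dot w (s - z)) -> dot w (x - z) <= 0.
  move=> wA; have [->|w0] := eqVneq w 0; first by rewrite dotC dot0.
  rewrite leNgt; apply/negP => /ltW.
  by rewrite -(max_avoiding_halfspace Amax) ?(negPf xA).
have [w0 w0A] := avoiding_halfspace AS Az.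
(* By Farkas, [E] consists of the b for which (z - x) - b (y - z) lies in the cone of A - z. It
   contains 0, is bounded because [w0] is positive at [y], and attains its supremum because its
   inequalities are not strict. *)
pose E : set R := [set b | forall w, (forall s, s \in A -> 0 <= dot w (s - z)) ->
  b * dot w (y - z) <= - dot w (x - z)].
have E0 : E 0 by move=> w wA; rewrite mul0r oppr_ge0 neg_x.
have Esup : has_sup E.
  split; first by exists 0.
  exists (- dot w0 (x - z) / dot w0 (y - z)) => b /(_ w0) bE.
  by rewrite ler_pdivlMr ?w0A// bE// => s sA; rewrite ltW ?w0A.
pose b := sup E.
have b0 : 0 <= b by apply: ub_le_sup E0; case: Esup.
have bE : E b.
  move=> w wA; have [wy|wy] := leP (dot w (y - z)) 0.
    have -> : dot w (y - z) = 0 by apply/eqP; rewrite eq_le wy wA.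
    by rewrite mulr0 oppr_ge0 neg_x.
  rewrite -ler_pdivlMr//; apply: ge_sup; first by exists 0.
  by move=> c /(_ w wA); rewrite ler_pdivlMr.
pose p := - (x - z) - b *: (y - z).
have dotp w : dot w p = - dot w (x - z) - b * dot w (y - z).
  by rewrite dotDr !dotNr dotZr.
case: (farkas (fun s => s - z) p (fset_uniq A)) => [[l l0 pE]|[w wA]]; last first.
  by rewrite dotp; have := bE w wA; lra.
(* Otherwise Farkas, with [None] indexing the generator -p, puts c p - (y - z) in the cone for some
   c >= 0. Adding p and dividing by c + 1 puts b + 1 / (c + 1) in [E], beyond its supremum. *)
have [w [wA wp wy]] : exists w, [/\ forall s, s \in A -> 0 <= dot w (s - z),
    dot w p <= 0 & 0 < dot w (y - z)].
  pose f o := if o is Some s then s - z else - p.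
  have us : uniq (None :: [seq Some s | s <- A]).
    by rewrite /= map_inj_uniq ?fset_uniq ?andbT => [|? ? []//]; apply/mapP => -[].
  case: (farkas f (- (y - z)) us) => [[c c0 cE]|[w wf wy]]; last first.
    exists w; split => [s sA||].
    - by apply: (wf (Some s)); rewrite inE map_f.
    - by have := wf None (mem_head _ _); rewrite dotNr oppr_ge0.
    - by rewrite dotNr oppr_lt0 in wy.
  pose e := (c None + 1)^-1.
  have e0 : 0 < e by rewrite invr_gt0; have := c0 None; lra.
  have : E (b + e).
    move=> w wA; have wpge0 : 0 <= dot w p.
      by rewrite pE dot_comb big_seq sumr_ge0// => s sA; rewrite mulr_ge0 ?wA.
    have : 0 <= dot w (- (y - z)) + c None * dot w p.
      rewrite cE big_cons big_map (dotDr _ (_ *: _)) dotZr [f None]/= dotNr.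
      rewrite dot_comb mulrN addrAC addNr add0r big_seq sumr_ge0// => s sA.
      by rewrite mulr_ge0 ?wA.
    rewrite dotNr => h.
    have {}h : e * dot w (y - z) <= dot w p.
      by rewrite mulrC ler_pdivrMr; [lra|have := c0 None; lra].
    by move: h; rewrite dotp; lra.
  by move/(ub_le_sup Esup.2); rewrite -/b; lra.
(* As [p] lies in the cone, w p = 0, so [p] only uses points of [A] on the hyperplane of [w]. *)
have wl s : s \in A -> l s * dot w (s - z) = 0.
  move=> sA; have : dot w p = 0.
    apply/eqP; rewrite eq_le wp pE dot_comb big_seq sumr_ge0// => t tA.
    by rewrite mulr_ge0 ?wA.
  move/eqP; rewrite pE dot_comb big_seq psumr_eq0 => [|t tA].
    by move=> /allP/(_ _ sA); rewrite sA => /eqP.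
  by rewrite mulr_ge0 ?wA.
pose X := (x |` [fset s in A | (dot w (s - z) == 0) || (s == y)])%fset.
have XxA : (X `<=` x |` A)%fset.
  by apply: fsetUS; apply/fsubsetP => s; rewrite !inE => /andP[].
have xAS : (x |` A `<=` S)%fset by rewrite fsubUset fsub1set xS.
have XS := fsubset_trans XxA xAS.
(* A functional positive on [X] would be nonnegative at [p], a combination of points of [X], yet
   negative at -(x - z) - b (y - z), which is [p]. *)
have Xz : z_containing z X.
  apply: contrapT => /(avoiding_halfspace XS)[u uX].
  have ux : 0 < dot u (x - z) by rewrite uX// !inE eqxx.
  have uy : 0 < dot u (y - z) by rewrite uX// !inE/= yA eqxx !orbT.
  have : 0 <= dot u p.
    rewrite pE dot_comb big_seq sumr_ge0// => s sA.
    move/eqP: (wl s sA); rewrite mulf_eq0 => /orP[/eqP->|ws]; first by rewrite mul0r.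
    by rewrite mulr_ge0// ltW ?uX// !inE/= sA ws orbT.
  by rewrite dotp; have := mulr_ge0 b0 (ltW uy); lra.
have [C CX Cmin] := min_containing_sub XS Xz.
have [CS Cz _] := min_containingP _ Cmin.
have CE s : s \in C -> s != x -> (s \in A) && ((dot w (s - z) == 0) || (s == y)).
  by move=> /(fsubsetP CX); rewrite !inE/= => /orP[->|].
have Cconv := (containingE CS).1 Cz.
have xC : x \in C.
  apply/negPn/negP => xC; apply: (conv_open_halfspaceF Cconv (w := w0)) => s sC.
  by apply: w0A; case/andP: (CE _ sC (memPn xC _ sC)).
(* Without [y], the functional - w would be nonnegative on [C], hence zero by general position. *)
have yC : y \in C.
  apply/negPn/negP => yC.
  have w0C : - w = 0.
    apply: (general_position_supporting gp CS Cconv) => s sC.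
    rewrite dotNl oppr_ge0; have [->|sx] := eqVneq s x; first exact: neg_x.
    case/andP: (CE s sC sx) => _; rewrite (negPf (memPn yC _ sC)) orbF.
    by move/eqP->.
  by move: wy; rewrite -[w]opprK w0C dotNl dotC dot0 oppr0 ltxx.
exists w, C; split => //; first by split => //; apply: fsubset_trans CX XxA.
move=> s sC sx sy; case/andP: (CE s sC sx) => _.
by rewrite (negPf sy) orbF => /eqP.
Qed.

(* Since [y] comes first in [A], it comes first in [C] minus [x], so the pair
   [(C, x)] determines [y], then [w] up to a positive factor, then [A]. *)
Definition facet_code A C x := exists y w,
  [/\ y \in A, forall s, s \in A -> (index y S <= index s S)%N
    & [/\ forall s, s \in A -> 0 <= dot w (s - z),
    0 < dot w (y - z),
    C \in min_containing z S,
    [/\ x \in C, x \notin A, y \in C & (C `<=` x |` A)%fset]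
    & forall s, s \in C -> s != x -> s != y -> dot w (s - z) = 0]].

Lemma facet_code_exists A : z_containing z S -> A \in max_avoiding z S ->
  A != fset0 -> exists C x, facet_code A C x.
Proof.
move=> Sz Amax /fset0Pn[y0 y0A].
have [AS Az _] := max_avoidingP _ Amax.
have [t _ tmin] := @arg_minnP A [` y0A]%fset predT
  (fun t => index (val t) S) isT.
have /fsubsetPn[x xS xA] : ~~ (S `<=` A)%fset.
  apply/negP => SA; apply: Az; suff -> : A = S by [].
  by apply/eqP; rewrite eqEfsubset AS.
have [w [C [wA wy Cmin [xC yC CA] wC]]] :=
  pulling_facet Amax (valP t) xS xA.
exists C, x, (val t), w; split => //; first exact: (valP t).
by move=> s sA; apply: (tmin [` sA]%fset).
Qed.

Lemma facet_code_inj A A' C x :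
  A \in max_avoiding z S -> A' \in max_avoiding z S ->
  facet_code A C x -> facet_code A' C x -> A = A'.
Proof.
move=> Amax A'max [y [w [yA ymin [wA wy Cmin [xC xA yC CA] wC]]]].
move=> [y' [w' [y'A' y'min [w'A' w'y' _ [_ xA' y'C CA'] w'C]]]].
have [AS _ _] := max_avoidingP _ Amax.
have [A'S _ _] := max_avoidingP _ A'max.
have [CS Cz _] := min_containingP _ Cmin.
have notx (B : {fset 'rV[R]_d}) t : t \in B -> x \notin B -> t != x.
  by move=> tB; apply: contraNneq => <-.
(* Both first points lie in [C] and differ from [x], so both lie in [A] and in [A'], and each index
   is at most the other. *)
have yE : y' = y.
  have yA' : y \in A'.
    by have := fsubsetP CA' _ yC; rewrite in_fset1U (negPf (notx _ _ yA xA)).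
  have y'A : y' \in A.
    by have := fsubsetP CA _ y'C; rewrite in_fset1U (negPf (notx _ _ y'A' xA')).
  have := anti_leq (introT andP (conj (ymin _ y'A) (y'min _ yA'))).
  by move/(index_inj z (fsubsetP AS _ yA) (fsubsetP AS _ y'A)).
rewrite {y'}yE in y'A' y'min w'y' w'C y'C.
(* Normalised to 1 at [y], the two functionals agree on [C] except perhaps at [x]. So [u] or its
   opposite is nonnegative on all of [C], and [u] is 0 by general position. *)
pose u := (dot w (y - z))^-1 *: w - (dot w' (y - z))^-1 *: w'.
have uC s : s \in C -> s != x -> dot u (s - z) = 0.
  move=> sC sx; rewrite dotDl dotNl !dotZl; have [->|sy] := eqVneq s y.
    by rewrite !mulVf ?subrr ?gt_eqF.
  by rewrite (wC s)// (w'C s)// !mulr0 subrr.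
have u0 : u = 0.
  have Cconv := (containingE CS).1 Cz.
  have [ux|ux] := leP 0 (dot u (x - z)).
    apply: (general_position_supporting gp CS Cconv) => s sC.
    by have [->//|sx] := eqVneq s x; rewrite uC.
  apply/eqP; rewrite -oppr_eq0; apply/eqP.
  apply: (general_position_supporting gp CS Cconv) => s sC.
  rewrite dotNl oppr_ge0.
  by have [->|sx] := eqVneq s x; [exact: ltW | rewrite uC].
have neq0 v : 0 < dot v (y - z) -> v != 0.
  by apply: contraTneq => ->; rewrite /dot mul0mx mxE ltxx.
have sgn s : (0 <= dot w (s - z)) = (0 <= dot w' (s - z)).
  have : dot u (s - z) = 0 by rewrite u0 /dot mul0mx mxE.
  rewrite dotDl dotNl !dotZl => /eqP; rewrite subr_eq0 => /eqP h.
  by rewrite -(pmulr_rge0 (dot w _) (x := (dot w (y - z))^-1)) ?invr_gt0// h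
    pmulr_rge0 ?invr_gt0.
apply/fsetP => s; have [sS|sS] := boolP (s \in S).
  rewrite (max_avoiding_halfspace Amax (neq0 _ wy))//.
  by rewrite (max_avoiding_halfspace A'max (neq0 _ w'y')).
by rewrite (contraNF (fsubsetP AS s) sS) (contraNF (fsubsetP A'S s) sS).
Qed.

End Avoiding.

(** * Counting the maximal avoiding sets by their codes *)

Local Open Scope fset_scope.

Theorem theorem3p1 (R : realType) (d : nat)
    (S : {fset 'rV[R]_d}) (z : 'rV[R]_d)
    (Sz : z_containing z S) (gpz : general_position z S) :
  (#|` max_avoiding z S| <= d.+1 * #|` min_containing z S|)%N.
Proof.
(* An empty maximal avoiding set has no first point, but it is then the only one, and some minimal
   containing set exists. *)
have [A0max|A0max] := boolP (fset0 \in max_avoiding z S).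
  have [_ _ A0top] := max_avoidingP _ _ _ A0max.
  have [C _ Cmin] := min_containing_sub (fsubset_refl S) Sz.
  have C_gt0 : (0 < #|` min_containing z S|)%N.
    by rewrite cardfs_gt0; apply/fset0Pn; exists C.
  apply: leq_trans (leq_pmulr _ C_gt0).
  apply: (@leq_trans #|` [fset fset0 : {fset 'rV[R]_d}]|); last by rewrite cardfs1.
  apply: fsubset_leq_card; apply/fsubsetP => A.
  case/max_avoidingP => AS Az _; rewrite in_fset1; apply/eqP.
  by apply: A0top.
have codes A : exists q : {fset 'rV[R]_d} * 'rV[R]_d,
    A \in max_avoiding z S -> facet_code z S A q.1 q.2.
  have [Amax|] := boolP (A \in _); last by exists (fset0, 0%R).
  have [|C [x AC]] := facet_code_exists gpz Sz Amax; last by exists (C, x).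
  by apply: contraNneq A0max => <-.
have {codes}[q qP] := choice codes.
have qinj : {in max_avoiding z S &, injective q}.
  move=> A A' Amax A'max qAA'; have := qP _ A'max; rewrite -qAA'.
  exact: (facet_code_inj gpz Amax A'max (qP _ Amax)).
(* All pairs of a minimal containing set and one of its points; the length is the sum of the sizes
   of these sets, each at most d + 1. *)
pose r := [seq (C, x) | C : {fset 'rV[R]_d} <- min_containing z S, x <- enum_fset C].
have : {subset [seq q A | A <- max_avoiding z S] <= r}.
  move=> _ /mapP[A Amax ->]; have := qP _ Amax.
  case: (q A) => C x [y [w [_ _ [_ _ Cmin [xC _ _ _] _]]]].
  by apply/allpairsPdep; exists C, x.
move/uniq_leq_size; rewrite map_inj_in_uniq ?fset_uniq// size_map => /(_ isT).
move/leq_trans; apply; rewrite size_allpairs_dep.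
have : {in enum_fset (min_containing z S),
    forall C : {fset 'rV[R]_d}, #|` C| <= d.+1}%N.
  by move=> C; apply: min_containing_card.
elim: (enum_fset _) => //= C s IH Cs; rewrite mulnS leq_add//.
  by apply: Cs; rewrite mem_head.
by apply: IH => D Ds; apply: Cs; rewrite inE Ds orbT.
Qed.
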